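(* Let $0 < \delta < 1$ and $\beta > 0$. Let $X_1, X_2, \ldots$ be a sequence of independent and identically distributed Bernoulli random variables having the same distribution as $X$, where $\Pr\{X = 1\} = 1 - \Pr\{X = 0\} = p \in (0,1)$. Define $$N = \min\left\{ n \in \mathbb{N} : \sum_{i=1}^n X_i > \frac{(1+\beta)\ln\frac{2}{\delta}}{(1+\beta)\ln(1+\beta) - \beta} \right\}, \qquad \widetilde{p} = \frac{1}{N}\sum_{i=1}^N X_i.$$ Then $$\Pr\left\{ \left|\frac{\widetilde{p} - p}{p}\right| < \beta \right\} \geq 1 - \delta.$$
   Context: $\mathbb{N}$ denotes the set of positive integers, $\ln$ the natural logarithm, and $\Pr\{\cdot\}$ the probability of an event. Since $p>0$, the stopping time $N$ is finite almost surely. *)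

(* Defs.v *)
From HB Require Import structures.
From mathcomp Require Import all_boot all_order all_algebra.
From mathcomp Require Import all_classical all_reals all_analysis.

Set Implicit Arguments.
Unset Strict Implicit.
Unset Printing Implicit Defensive.

Import Order.TTheory GRing.Theory Num.Theory.
Import numFieldNormedType.Exports.

Local Open Scope classical_set_scope.
Local Open Scope ring_scope.

Section random_variables.
Context {d : measure_display} {T : measurableType d} {R : realType}
  (P : probability T R).

(* Mutual independence: the product rule over every finite subfamily. *)
Definition independent_RVs (Xs : nat -> {RV P >-> R}) : Prop :=
  forall (s : seq nat) (B : nat -> set R), uniq s ->
    (forall i, measurable (B i)) ->
    P (\bigcap_(i in [set` s]) (Xs i @^-1` B i)) =
    (\prod_(i <- s) P (Xs i @^-1` B i))%E.

(* Only measurable sets are compared: the value of a measure on a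
   non-measurable set is unconstrained. *)
Definition same_distribution (X Y : {RV P >-> R}) : Prop :=
  forall B : set R, measurable B -> distribution P X B = distribution P Y B.

End random_variables.

Section inverse_sampling.
Context {T : Type} {R : realType} (Xs : nat -> T -> R).

(* [Xs i] is the (i+1)-st observation, so this is X_1 + ... + X_n. *)
Definition partial_sum (n : nat) (w : T) : R := \sum_(i < n) Xs i w.

Definition exceeds (c : R) (w : T) : pred nat :=
  fun n => (0 < n)%N && (c < partial_sum n w).

(* The least n >= 1 such that X_1 + ... + X_n > c, with the junk value 0 at the
   sample points where there is no such n. *)
Definition stopping_time (c : R) (w : T) : nat :=
  if pselect (exists n, exceeds c w n) is left h then ex_minn h else 0%N.

Definition sample_mean_at_stop (c : R) (w : T) : R :=
  partial_sum (stopping_time c w) w / (stopping_time c w)%:R.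

End inverse_sampling.

Definition threshold {R : realType} (beta delta : R) : R :=
  (1 + beta) * ln (2 / delta) / ((1 + beta) * ln (1 + beta) - beta).

(* Main.v *)
(* Let c be the threshold and k = truncn c + 1. Almost surely all observations
   are 0 or 1, hence the sum S_N at the stopping time N is exactly k and
   ptilde = k / N. If ptilde >= (1 + beta) p, then N <= n where
   n = truncn (k / (p (1 + beta))), so that S_n >= k. If
   ptilde <= (1 - beta) p with beta < 1, then N >= m where m is the least
   integer >= k / (p (1 - beta)), so that S_(m-1) <= k - 1 and therefore
   S_m <= k. Chernoff's inequality, with tilting factors 1 + beta and 1 - beta,
   bounds these two probabilities by exp (- k (ln (1 + beta) - beta / (1 + beta)))
   and exp (- k (beta / (1 - beta) + ln (1 - beta))). The first is at most
   delta / 2 because k > c, and the second is at most the first because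
   2 ln x <= x - 1 / x at x = (1 + beta) / (1 - beta). *)

Require Import Defs.
From HB Require Import structures.
From mathcomp Require Import all_boot all_order all_algebra.
From mathcomp Require Import all_classical all_reals all_analysis.
From mathcomp Require Import measurable_realfun.
From mathcomp Require Import ring lra.

Set Implicit Arguments.
Unset Strict Implicit.
Unset Printing Implicit Defensive.

Import Order.TTheory GRing.Theory Num.Theory.
Import numFieldNormedType.Exports.

Local Open Scope classical_set_scope.
Local Open Scope ring_scope.

(** * Inequalities for the exponential and the logarithm *)

Section real_inequalities.
Context {R : realType}.
Implicit Types x b : R.

Lemma expR_ge_quadratic x : 0 <= x -> 1 + x + x ^+ 2 / 2 <= expR x.
Proof.
move=> x0; have -> : 1 + x + x ^+ 2 / 2 = series (exp_coeff x) 3%N.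
  rewrite /series /= !big_nat_recl// big_nil /exp_coeff /=.
  by rewrite expr0 expr1 !fact0 !factS fact0 !muln1 !divr1 addr0 addrA.
apply: nondecreasing_cvgn_le; last exact: is_cvg_series_exp_coeff.
apply/nondecreasing_seqP => n; rewrite seriesSr lerDl.
exact: exp_coeff_ge0.
Qed.

(** Put [t = ln x]. Since [y - y^-1] increases with [y], the value [x = expR t] may be lowered to
    [y = 1 + t + t ^+ 2 / 2], and then [y ^+ 2 - 1 - 2 * t * y] is the perfect square
    [(t ^+ 2 / 2) ^+ 2]. *)
Lemma ln_le_half_sub_inv x : 1 <= x -> 2 * ln x <= x - x^-1.
Proof.
move=> x1; have x0 : 0 < x by lra.
have t0 : 0 <= ln x by exact: ln_ge0.
have := expR_ge_quadratic t0; rewrite lnK ?posrE//.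
move: (ln x) t0 => t t0 tx.
set y := 1 + t + t ^+ 2 / 2 in tx.
have y1 : 1 <= y by rewrite /y; nra.
have xy : x^-1 <= y^-1 by rewrite lef_pV2 ?posrE//; lra.
suff : 2 * t <= y - y^-1 by lra.
have yV : y * y^-1 = 1 by rewrite divff//; lra.
have yV0 : 0 < y^-1 by rewrite invr_gt0; lra.
suff : 0 <= (y ^+ 2 - 1 - 2 * t * y) * y^-1.
  have -> : (y ^+ 2 - 1 - 2 * t * y) * y^-1 = y * (y * y^-1) - y^-1 - 2 * t * (y * y^-1).
    by ring.
  by rewrite yV; lra.
apply: mulr_ge0; last exact: ltW.
have -> : y ^+ 2 - 1 - 2 * t * y = (t ^+ 2 / 2) ^+ 2.
  by rewrite /y; field.
exact: sqr_ge0.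
Qed.

(** This is [1 + u < expR u] at [u = - ln (1 + b)], multiplied by [1 + b]. *)
Lemma threshold_denominator_gt0 b : 0 < b -> 0 < (1 + b) * ln (1 + b) - b.
Proof.
move=> b0; have b1 : 0 < 1 + b by lra.
have l0 : - ln (1 + b) != 0 by rewrite oppr_eq0 gt_eqF// ln_gt0//; lra.
have := expR_gt1Dx l0; rewrite expRN lnK ?posrE// => h.
have := mulrV (unitf_gt0 b1); nra.
Qed.

Lemma upper_rate_le_lower_rate b : 0 < b -> b < 1 ->
  ln (1 + b) - b / (1 + b) <= b / (1 - b) + ln (1 - b).
Proof.
move=> b0 b1; have p0 : 0 < 1 + b by lra.
have m0 : 0 < 1 - b by lra.
have := @ln_le_half_sub_inv ((1 + b) / (1 - b)).
rewrite ler_pdivlMr// mul1r invf_div ln_div ?posrE// => h.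
have {}h := h ltac:(lra).
have : (1 + b) / (1 - b) - (1 - b) / (1 + b) = 2 * (b / (1 + b) + b / (1 - b)).
  by field; rewrite !gt_eqF.
lra.
Qed.

End real_inequalities.

(** * Pathwise behaviour of the stopping time *)

Section stopping.
Context {T : Type} {R : realType} {Xs : nat -> T -> R}.
Implicit Types (c : R) (w : T) (n : nat).

Variant stopping_time_spec c w : nat -> Prop :=
| StoppingTime n of exceeds Xs c w n & (forall m, exceeds Xs c w m -> (n <= m)%N) :
    stopping_time_spec c w n
| NoStoppingTime of (forall n, ~~ exceeds Xs c w n) : stopping_time_spec c w 0%N.

Lemma stopping_timeP c w : stopping_time_spec c w (stopping_time Xs c w).
Proof.
rewrite /stopping_time; case: pselect => [h|h].
  by case: ex_minnP => n en nmin; exact: StoppingTime.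
by apply: NoStoppingTime => n; apply/negP => en; apply: h; exists n.
Qed.

Lemma partial_sumS n w : partial_sum Xs n.+1 w = partial_sum Xs n w + Xs n w.
Proof. by rewrite /partial_sum big_ord_recr. Qed.

Section bits.
Context {w : T} (w_bits : forall i, Xs i w = 0 \/ Xs i w = 1).

Lemma partial_sum_nat n : exists m : nat, partial_sum Xs n w = m%:R.
Proof.
elim: n => [|n [m mE]]; first by exists 0%N; rewrite /partial_sum big_ord0.
rewrite partial_sumS mE; case: (w_bits n) => ->; first by exists m; rewrite addr0.
by exists m.+1; rewrite -natr1.
Qed.

Lemma partial_sum_homo : {homo (fun n => partial_sum Xs n w) : m n / (m <= n)%N >-> m <= n}.
Proof.
apply/nondecreasing_seqP => n; rewrite partial_sumS lerDl.
by case: (w_bits n) => ->.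
Qed.

(* The observations being integers, the sum jumps from at most [truncn c] to
   exactly [truncn c + 1]. *)
Lemma partial_sum_at_stop c m : 0 <= c ->
    (Num.truncn c).+1%:R < partial_sum Xs m w ->
  [/\ (0 < stopping_time Xs c w)%N, (stopping_time Xs c w < m)%N &
      partial_sum Xs (stopping_time Xs c w) w = (Num.truncn c).+1%:R].
Proof.
move=> c0 km.
(* An integer is above [c] iff it is at least [truncn c + 1]. The guard [0 < n] costs nothing, as
   the empty sum 0 stays below that level. *)
have exceedsE n : exceeds Xs c w n = ((Num.truncn c).+1%:R <= partial_sum Xs n w).
  case: n => [|n]; first by rewrite /exceeds /partial_sum big_ord0 lern0.
  by rewrite /exceeds; have [l ->] := partial_sum_nat n.+1; rewrite ler_nat -truncn_lt_nat.
case: stopping_timeP => [N|]; last by move=> /(_ m); rewrite exceedsE ltW.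
rewrite exceedsE; case: N => [|N].
  by rewrite /partial_sum big_ord0 lern0.
move=> kN Nmin.
have NE : partial_sum Xs N.+1 w = (Num.truncn c).+1%:R.
  apply/eqP; rewrite eq_le kN andbT.
  have : ~~ exceeds Xs c w N by apply/negP => /Nmin; rewrite ltnn.
  rewrite exceedsE partial_sumS; have [l ->] := partial_sum_nat N.
  rewrite ler_nat -ltnNge ltnS => lk; rewrite -natr1.
  by apply: lerD; rewrite ?ler_nat//; case: (w_bits N) => ->.
split=> //; rewrite ltnNge; apply/negP => /partial_sum_homo.
by rewrite NE leNgt km.
Qed.

End bits.
End stopping.

(** * Measurability of the stopping time and of the stopped mean *)

Section measurability.
Context {d : measure_display} {T : measurableType d} {R : realType}
  {P : probability T R} (Xs : nat -> {RV P >-> R}).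

Lemma measurable_partial_sum n : measurable_fun setT (partial_sum Xs n).
Proof. by apply: measurable_sum => i; exact: measurable_funPT. Qed.

Lemma measurable_exceeds c n : measurable [set w | exceeds Xs c w n].
Proof.
have mE : measurable [set w | c < partial_sum Xs n w].
  rewrite -[X in measurable X]setTI.
  rewrite (_ : mkset _ = partial_sum Xs n @^-1` `]c, +oo[).
    by apply: measurable_partial_sum => //; exact: measurable_itv.
  by apply/seteqP; split=> w /=; rewrite in_itv/= andbT.
case: n mE => [|n] mE; last exact: mE.
by rewrite (_ : mkset _ = set0)//; apply/seteqP; split.
Qed.

Lemma measurable_stopping_time_eq c n :
  measurable [set w | stopping_time Xs c w = n].
Proof.
case: n => [|n].
  (* [exceeds] is false at 0, so the value 0 marks exactly the paths that never stop. *)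
  rewrite (_ : mkset _ = \bigcap_n ~` [set w | exceeds Xs c w n]).
    by apply: bigcapT_measurable => n; apply: measurableC; exact: measurable_exceeds.
  apply/seteqP; split=> w /=.
    case: stopping_timeP => [n en _ n0|ne _ n _]; last exact/negP.
    by move: en; rewrite n0.
  case: stopping_timeP => // n en _ /(_ n I) /=.
  by rewrite en.
rewrite (_ : mkset _ = [set w | exceeds Xs c w n.+1] `&`
    \bigcap_(m in [set m | (m < n.+1)%N]) ~` [set w | exceeds Xs c w m]).
  apply: measurableI; first exact: measurable_exceeds.
  by apply: bigcap_measurableType => m _; apply: measurableC; exact: measurable_exceeds.
apply/seteqP; split=> w /=.
  case: stopping_timeP => // N eN Nmin NE; split; first by rewrite -NE.
  by move=> m /= mn /Nmin; rewrite NE leqNgt mn.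
case: stopping_timeP => [N eN Nmin|ne] [en nmin]; last by have := ne n.+1; rewrite en.
apply/eqP; rewrite eqn_leq Nmin//= leqNgt; apply/negP => /nmin; exact.
Qed.

(** The stopping time has countably many values, and where it equals [n] the mean is the measurable
    [partial_sum Xs n w / n%:R]. *)
Lemma measurable_sample_mean_at_stop c :
  measurable_fun setT (sample_mean_at_stop Xs c).
Proof.
move=> _ B mB; rewrite setTI (_ : _ @^-1` _ =
    \bigcup_n ([set w | stopping_time Xs c w = n] `&`
               (fun w => partial_sum Xs n w / n%:R) @^-1` B)).
  apply: bigcupT_measurable => n; apply: measurableI.
    exact: measurable_stopping_time_eq.
  rewrite -[X in measurable X]setTI.
  by apply: measurable_funM => //; exact: measurable_partial_sum.
apply/seteqP; split=> w /=; first by exists (stopping_time Xs c w).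
by move=> [n _ [<-]].
Qed.

End measurability.

(** * Chernoff's bound for Bernoulli sums *)

Section chernoff.
Context {d : measure_display} {T : measurableType d} {R : realType}
  {P : probability T R} (Xs : nat -> {RV P >-> R}) (p : R)
  (p_ge0 : 0 <= p) (p_le1 : p <= 1)
  (Xs_indep : independent_RVs Xs)
  (Xs_eq1 : forall i, P (Xs i @^-1` [set 1]) = p%:E)
  (Xs_eq0 : forall i, P (Xs i @^-1` [set 0]) = (1 - p)%:E).

Lemma measure_bigsetU_le (I : finType) (Q : pred I) (F : I -> set T) :
    (forall i, measurable (F i)) ->
  (P (\big[setU/set0]_(i | Q i) F i) <= \sum_(i | Q i) P (F i))%E.
Proof.
(* The induction carries measurability along, because subadditivity asks for it at each union. *)
move=> mF; pose K A x := measurable A /\ (P A <= x)%E.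
suff [] : K (\big[setU/set0]_(i | Q i) F i) (\sum_(i | Q i) P (F i))%E by [].
apply: big_ind2 => [|A x B y [mA Ax] [mB By]|i _].
- by split; rewrite ?measure0.
- split; first exact: measurableU.
  by apply: le_trans (leeD Ax By); exact: measureU2.
- by split.
Qed.

Lemma measurable_preimage1 i x : measurable (Xs i @^-1` [set x]).
Proof. by apply: measurable_funPTI; exact: measurable_set1. Qed.

(** Real-valued observations may differ from 0 and 1, but only on this null set; the pathwise
    arguments run outside it. *)
Definition non_bits : set T := \bigcup_i Xs i @^-1` ~` [set 0; 1].

Lemma measurable_non_bits : measurable non_bits.
Proof.
apply: bigcupT_measurable => i; apply: measurable_funPTI.
by apply: measurableC; apply: measurableU; exact: measurable_set1.
Qed.

Lemma non_bits_eq0 : P non_bits = 0%E.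
Proof.
apply: measure_negligible; first exact: measurable_non_bits.
apply: negligible_bigcup => i.
rewrite -preimage_setC preimage_setU.
have m0 := measurable_preimage1 i 0; have m1 := measurable_preimage1 i 1.
have m01 := measurableU _ _ m0 m1.
apply/negligibleP; first exact: measurableC.
apply: (etrans (probability_setC P m01)); apply: (etrans _ (subee (x := 1%E) erefl)).
congr (_ - _)%E.
apply: esym.
transitivity (P (Xs i @^-1` [set 0%R]) + P (Xs i @^-1` [set 1%R]))%E.
  by rewrite Xs_eq0 Xs_eq1 -EFinD subrK.
apply/esym/measureU => //; apply/seteqP; split=> w //= [-> /eqP].
by rewrite eq_sym oner_eq0.
Qed.

Lemma not_non_bits w : ~ non_bits w -> forall i, Xs i w = 0 \/ Xs i w = 1.
Proof. by move=> wb i; apply: contrapT => wi; apply: wb; exists i. Qed.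

(** The word [b] is extended by [false] to all indices, since [independent_RVs] takes a family of
    sets indexed by [nat]. *)
Definition cylinder n (b : {ffun 'I_n -> bool}) : set T :=
  \bigcap_(i in [set` iota 0 n]) Xs i @^-1` [set (oapp b false (insub i))%:R].

Lemma measurable_cylinder n (b : {ffun 'I_n -> bool}) : measurable (cylinder b).
Proof.
by apply: bigcap_measurableType => i _; exact: measurable_preimage1.
Qed.

Lemma measure_cylinder n (b : {ffun 'I_n -> bool}) :
  P (cylinder b) = (\prod_(i < n) if b i then p else 1 - p)%:E.
Proof.
rewrite /cylinder (Xs_indep (B := fun i => [set (oapp b false (insub i))%:R])) ?iota_uniq//.
rewrite -[iota 0 n](_ : index_iota 0 n = _); last by rewrite /index_iota subn0.
rewrite big_mkord -prodEFin; apply: eq_bigr => i _.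
by rewrite valK /=; case: (b i).
Qed.

Lemma cylinder_cover n w : ~ non_bits w ->
  exists2 b : {ffun 'I_n -> bool}, cylinder b w & partial_sum Xs n w = (\sum_i b i)%:R.
Proof.
move=> /not_non_bits wb; pose b := [ffun i : 'I_n => Xs i w == 1].
have bE (i : 'I_n) : Xs i w = (b i)%:R.
  by rewrite ffunE; case: (wb i) => ->; rewrite ?eqxx// eq_sym oner_eq0.
exists b; last by rewrite /partial_sum natr_sum; apply: eq_bigr.
move=> i /=; rewrite mem_iota => /andP[_ ni].
by rewrite (insubT (fun i => i < n)%N ni) /= -bE.
Qed.

(* Summing over the 2^n cylinders replaces the product rule for expectations
   of independent variables. *)
Lemma chernoff_bound n k (r : R) (A : set T) : 0 < r -> measurable A ->
    (forall w m, A w -> partial_sum Xs n w = m%:R -> r ^+ k <= r ^+ m) ->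
  (P A <= (expR (n%:R * p * (r - 1) - k%:R * ln r))%:E)%E.
Proof.
move=> r0 mA Ak.
(* For [r > 1] this condition says that the word has at least [k] ones, for [r < 1] at most [k]: one
   statement serves both tails. *)
pose Q (b : {ffun 'I_n -> bool}) := r ^+ k <= r ^+ (\sum_i b i).
pose U := \big[setU/set0]_(b | Q b) cylinder b.
have mU : measurable U by apply: bigsetU_measurable => b _; exact: measurable_cylinder.
have AU : A `<=` non_bits `|` U.
  move=> w Aw; have [wb|wb] := pselect (non_bits w); [by left|right].
  have [b bw bE] := cylinder_cover n wb.
  by rewrite /U (bigD1 b)//=; [left|exact: Ak bE].
apply: (@le_trans _ _ (P U)).
  rewrite -[leRHS]add0e -non_bits_eq0.
  apply: le_trans (measureU2 P measurable_non_bits mU).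
  by apply: le_measure; rewrite ?inE//; apply: measurableU => //; exact: measurable_non_bits.
apply: le_trans (measure_bigsetU_le Q (@measurable_cylinder n)) _.
under eq_bigr do rewrite measure_cylinder.
rewrite sumEFin lee_fin.
have rk0 : 0 < r ^+ k by exact: exprn_gt0.
have w0 (b : {ffun 'I_n -> bool}) : 0 <= \prod_(i < n) (if b i then p else 1 - p).
  by apply: prodr_ge0 => i _; case: (b i); rewrite ?subr_ge0.
(* Markov's step: words in [Q] gain a factor [r ^+ (\sum_i b i) / r ^+ k], which is at least 1, and
   the other words add nonnegative terms. *)
apply: (@le_trans _ _
    (\sum_(b : {ffun 'I_n -> bool}) \prod_(i < n) (if b i then p * r else 1 - p) / r ^+ k)).
  rewrite big_mkcond; apply: ler_sum => b _.
  have -> : \prod_(i < n) (if b i then p * r else 1 - p) =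
      \prod_(i < n) (if b i then p else 1 - p) * r ^+ (\sum_i b i).
    rewrite -prodrXr -big_split; apply: eq_bigr => i _ /=.
    by case: (b i); rewrite ?expr1// expr0 mulr1.
  case: ifPn => [Qb|_].
    by rewrite -mulrA ler_peMr// ler_pdivlMr// mul1r.
  by rewrite mulr_ge0 ?invr_ge0 ?(ltW rk0)// mulr_ge0 ?exprn_ge0 ?(ltW r0)//; exact: w0.
(* The sum of products factors as [(p * r + (1 - p)) ^+ n], whose base is [1 + p * (r - 1)], at most
   [expR (p * (r - 1))]. *)
rewrite -big_distrl /= -(bigA_distr_bigA (fun _ (b : bool) => if b then p * r else 1 - p)) /=.
rewrite big_const_ord iter_mulr_1 big_bool/=.
rewrite expRB -mulrA !expRM_natl lnK ?posrE// ler_pM2r ?invr_gt0//.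
apply: lerXn2r; rewrite ?nnegrE ?expR_ge0//.
  by rewrite addr_ge0 ?subr_ge0// mulr_ge0// ltW.
by apply: le_trans (expR_ge1Dx _); rewrite mulrBr mulr1 addrCA addrA.
Qed.

End chernoff.

(** * Comparing the exponents with [ln (2 / delta)] *)

Section tail_rates.
Context {R : realType}.
Implicit Types delta beta p : R.

Lemma ln_two_div_gt0 delta : 0 < delta -> delta < 1 -> 0 < ln (2 / delta).
Proof. by move=> delta_gt0 delta_lt1; apply: ln_gt0; rewrite ltr_pdivlMr//; lra. Qed.

Lemma threshold_ge0 delta beta : 0 < delta -> delta < 1 -> 0 < beta ->
  0 <= threshold beta delta.
Proof.
move=> delta_gt0 delta_lt1 beta_gt0.
have L0 := ln_two_div_gt0 delta_gt0 delta_lt1.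
have D0 := threshold_denominator_gt0 beta_gt0.
by apply: divr_ge0 (ltW D0); apply: mulr_ge0 (ltW L0); lra.
Qed.

Lemma expR_le_half delta x : 0 < delta ->
  x <= - ln (2 / delta) -> expR x <= delta / 2.
Proof.
move=> delta_gt0.
rewrite -[_ <= - _]ler_expR expRN lnK ?posrE ?invf_div//.
by apply: divr_gt0; lra.
Qed.

(** Multiplied by [1 + beta], the rate on the right becomes the denominator of [threshold]. *)
Lemma ln_le_upper_rate delta beta (k : nat) : 0 < beta ->
    threshold beta delta < k%:R ->
  ln (2 / delta) <= k%:R * (ln (1 + beta) - beta / (1 + beta)).
Proof.
move=> beta_gt0.
have D0 := threshold_denominator_gt0 beta_gt0.
rewrite ltr_pdivrMr// => /ltW Lk.
have b0 : 0 < 1 + beta by lra.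
rewrite -(ler_pM2l b0) (le_trans Lk)// le_eqVlt; apply/orP; left; apply/eqP.
by field; rewrite gt_eqF.
Qed.

Lemma upper_tail_rate delta beta p (k n : nat) : 0 < delta -> 0 < beta -> 0 < p ->
    threshold beta delta < k%:R ->
    n%:R <= k%:R / (p * (1 + beta)) ->
  expR (n%:R * p * (1 + beta - 1) - k%:R * ln (1 + beta)) <= delta / 2.
Proof.
move=> delta_gt0 beta_gt0 p_gt0 /(ln_le_upper_rate beta_gt0) Lk; have b0 : 0 < 1 + beta by lra.
rewrite ler_pdivlMr ?mulr_gt0// mulrA -ler_pdivlMr// => nk.
apply: expR_le_half => //.
have := ler_wpM2r (ltW beta_gt0) nk.
lra.
Qed.

(* For [beta >= 1] the mean cannot be too small, and the event
   [partial_sum m <= k] only has to account for sampling not yet stopped. *)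
Lemma exists_lower_tail_rate delta beta p (k : nat) :
    0 < delta -> delta < 1 -> 0 < beta -> 0 < p -> threshold beta delta < k%:R ->
  exists r m, [/\ 0 < r <= 1,
    expR (m%:R * p * (r - 1) - k%:R * ln r) <= delta / 2 &
    forall n : nat, (0 < n < m)%N -> p * (1 - beta) < k%:R / n%:R].
Proof.
move=> delta_gt0 delta_lt1 beta_gt0 p_gt0 ck; have Lk := ln_le_upper_rate beta_gt0 ck.
have k0 : 0 < k%:R :> R by apply: le_lt_trans ck; exact: threshold_ge0.
have [beta_lt1|beta_ge1] := ltP beta 1.
  have b0 : 0 < 1 - beta by lra.
  have pb0 : 0 < p * (1 - beta) by exact: mulr_gt0.
  have : exists m, k%:R / (p * (1 - beta)) <= m%:R.
    by eexists; apply: ltW; exact: truncnS_gt.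
  case/ex_minnP => m km m_min; exists (1 - beta), m; split; first lra.
  - apply: expR_le_half => //.
    move: km; rewrite ler_pdivrMr// mulrA -ler_pdivrMr// => km.
    have := ler_wpM2r (ltW beta_gt0) km.
    have := ler_wpM2l (ltW k0) (upper_rate_le_lower_rate beta_gt0 beta_lt1).
    lra.
  - move=> n /andP[n0 nm]; rewrite ltr_pdivlMr ?ltr0n// mulrC -ltr_pdivlMr//.
    by rewrite ltNge; apply/negP => /m_min; rewrite leqNgt nm.
(* With [r = 1 / 2] the exponent is [- m%:R * p / 2 - k%:R * ln (1 / 2)], which equals
   [- ln (2 / delta)] when [m%:R] is replaced by [y]. *)
pose y := 2 * (ln (2 / delta) - k%:R * ln (1 / 2)) / p.
exists (1 / 2), (Num.truncn y).+1; split; first lra.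
- apply: expR_le_half => //; have := truncnS_gt y.
  rewrite {1}/y ltr_pdivrMr//; lra.
- move=> n /andP[n0 _]; apply: (@le_lt_trans _ _ 0); first by nra.
  by rewrite divr_gt0// ltr0n.
Qed.

End tail_rates.

(** * Union bound over the two tails *)

Theorem theorem8 (d : measure_display) (T : measurableType d) (R : realType)
  (P : probability T R) (delta beta p : R)
  (X : {RV P >-> R}) (Xs : nat -> {RV P >-> R})
  (delta_gt0 : 0 < delta) (delta_lt1 : delta < 1) (beta_gt0 : 0 < beta)
  (p_gt0 : 0 < p) (p_lt1 : p < 1)
  (X_eq1 : P [set w | X w = 1] = (1 - P [set w | X w = 0%R])%E)
  (X_eq0 : (1 - P [set w | X w = 0%R])%E = p%:E)
  (Xs_indep : independent_RVs Xs)
  (Xs_distr : forall i, same_distribution (Xs i) X) :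
  let ptilde := sample_mean_at_stop Xs (threshold beta delta) in
  ((1 - delta)%:E <= P [set w | `|(ptilde w - p) / p| < beta]%R)%E.
Proof.
cbv zeta; set ptilde := sample_mean_at_stop _ _.
have Xs_eq1 i : P (Xs i @^-1` [set 1]) = p%:E.
  have := Xs_distr i [set 1] (measurable_set1 _).
  by rewrite /distribution/= /pushforward => ->; rewrite -X_eq0 -X_eq1.
have Xs_eq0 i : P (Xs i @^-1` [set 0]) = (1 - p)%:E.
  have := fin_num_measure P _ (measurable_preimage1 Xs i 0).
  have -> : P (Xs i @^-1` [set 0]) = P [set w | X w = 0].
    exact: Xs_distr (measurable_set1 _).
  by move: X_eq0; case: (P _) => // x [<-] _; rewrite opprB addrC subrK.
set c := threshold beta delta in ptilde *.
have c0 : 0 <= c by exact: threshold_ge0.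
pose k := (Num.truncn c).+1.
have ck : c < k%:R by exact: truncnS_gt.
have b0 : 0 < 1 + beta by lra.
have pb0 : 0 < p * (1 + beta) by exact: mulr_gt0.
(* The largest integer [n] with [n <= k / (p * (1 + beta))], so any [N > n] satisfies
   [k / N < p * (1 + beta)]. *)
pose n := Num.truncn (k%:R / (p * (1 + beta))).
have nk : n%:R <= k%:R / (p * (1 + beta)) by rewrite truncn_le divr_ge0// ltW.
have [r [m [/andP[r0 r1] lower_rate lower]]] :=
  exists_lower_tail_rate delta_gt0 delta_lt1 beta_gt0 p_gt0 ck.
pose A := [set w | k%:R <= partial_sum Xs n w].
pose B := [set w | partial_sum Xs m w <= k%:R].
have mA : measurable A.
  rewrite (_ : A = partial_sum Xs n @^-1` `[k%:R, +oo[).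
    rewrite -[X in measurable X]setTI.
    by apply: measurable_partial_sum => //; exact: measurable_itv.
  by apply/seteqP; split=> w /=; rewrite in_itv/= andbT.
have mB : measurable B.
  rewrite (_ : B = partial_sum Xs m @^-1` `]-oo, k%:R]).
    rewrite -[X in measurable X]setTI.
    by apply: measurable_partial_sum => //; exact: measurable_itv.
  by apply/seteqP; split=> w /=; rewrite in_itv.
have chernoff := chernoff_bound (ltW p_gt0) (ltW p_lt1) Xs_indep Xs_eq1 Xs_eq0.
have PA : (P A <= (delta / 2)%:E)%E.
  apply: le_trans (chernoff n k (1 + beta) A b0 mA _) _; last first.
    by rewrite lee_fin; exact: upper_tail_rate delta_gt0 beta_gt0 p_gt0 ck nk.
  move=> w j; rewrite /A/= => + jE; rewrite jE ler_nat => kj.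
  by rewrite ler_weXn2l//; lra.
have PB : (P B <= (delta / 2)%:E)%E.
  apply: le_trans (chernoff m k r B r0 mB _) _; last by rewrite lee_fin.
  move=> w j; rewrite /B/= => + jE; rewrite jE ler_nat => jk.
  by rewrite ler_wiXn2l// ltW.
set E := [set w | _].
have mE : measurable E.
  have -> : E = ptilde @^-1` `](p * (1 - beta)), (p * (1 + beta))[.
    apply/seteqP; split=> w; rewrite /E/= in_itv/= ltr_norml;
    rewrite (ltr_pdivrMr _ _ p_gt0) (ltr_pdivlMr _ _ p_gt0);
    by move=> /andP[? ?]; apply/andP; split; lra.
  rewrite -[X in measurable X]setTI.
  by apply: measurable_sample_mean_at_stop => //; exact: measurable_itv.
have EC : ~` E `<=` non_bits Xs `|` (A `|` B).
  move=> w wE; apply: contrapT => /not_orP[/not_non_bits w_bits /not_orP[wA wB]].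
  apply: wE; have := @partial_sum_at_stop T R Xs w w_bits c m c0.
  (* Outside [B] the sum has passed [k] by time [m], so sampling stopped before [m], at a positive
     time and with sum exactly [k]. *)
  move: wB; rewrite /B/= => /negP; rewrite -ltNge => kS /(_ kS)[N0 Nm SN].
  rewrite /E/= /ptilde /sample_mean_at_stop SN.
  have nN : (n < stopping_time Xs c w)%N.
    rewrite ltnNge; apply/negP => /(@partial_sum_homo T R Xs w w_bits).
    by rewrite SN => /wA.
  have upper : k%:R / (stopping_time Xs c w)%:R < p * (1 + beta).
    rewrite ltr_pdivrMr ?ltr0n// mulrC -ltr_pdivrMr//.
    by rewrite -truncn_lt_nat// divr_ge0// ltW.
  have := lower (stopping_time Xs c w); rewrite N0 Nm => /(_ isT).
  rewrite -/k ltr_norml (ltr_pdivrMr _ _ p_gt0) (ltr_pdivlMr _ _ p_gt0) => lo.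
  by apply/andP; split; lra.
have mN := measurable_non_bits Xs.
have mAB := measurableU _ _ mA mB.
have PEC : (P (~` E) <= delta%:E)%E.
  apply: (@le_trans _ _ (P (non_bits Xs `|` (A `|` B)))).
    by apply: le_measure EC; rewrite inE; [exact: measurableC|exact: measurableU].
  apply: le_trans (measureU2 P mN mAB) _.
  rewrite [X in (X + _ <= _)%E](non_bits_eq0 Xs_eq1 Xs_eq0) add0e.
  apply: le_trans (measureU2 P mA mB) _.
  by apply: le_trans (leeD PA PB) _; rewrite -EFinD lee_fin; lra.
have := probability_setC P (measurableC mE); rewrite setCK => ->.
by rewrite EFinB leeB.
Qed.
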